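(* Let $(\{(G_\sigma, d_\sigma)\}_{\sigma \in \Sigma}, \{\alpha_{\sigma}^{\tau} \colon G_\sigma \to G_\tau\}_{\sigma \leqslant \tau})$ be a direct system, indexed by an upward directed set $\Sigma$, in the category of compact metric groups with bi-invariant metrics with non-expansive homomorphisms as arrows, and assume that $\alpha_\sigma^\tau$ is surjective for all $\sigma \leqslant \tau$. Then this system has an inductive limit in this category. Furthermore, (1) the object of the inductive limit does not depend, up to isometric isomorphism, on the choice of surjective arrows for the system: if $(\{(G_\sigma, d_\sigma)\}_{\sigma \in \Sigma}, \{\beta_{\sigma}^{\tau}\}_{\sigma \leqslant \tau})$ is another direct system in this category over the same $\Sigma$ with the same objects and with all arrows surjective, then the objects of the inductive limits of the two systems are isometrically isomorphic; (2) the arrows of the inductive limit are surjective.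
   Context: A metric group is a metrizable topological group $G$ together with a fixed left-invariant metric $d$ inducing its topology; it is a metric group with bi-invariant metric if $d$ is both left- and right-invariant. A mapping $f\colon (X,d)\to(Y,\varrho)$ is non-expansive if $\varrho(f(x),f(y))\leqslant d(x,y)$ for all $x,y\in X$. A direct system in a category $\mathsf A$ indexed by an upward directed set $\Sigma$ is a family of objects $\{A_\sigma\}_{\sigma\in\Sigma}$ with morphisms $\{\alpha_\sigma^\tau\colon A_\sigma\to A_\tau\}_{\sigma\leqslant\tau}$ such that $\alpha_\sigma^\sigma=\mathrm{id}_{A_\sigma}$ and $\alpha_\varrho^\tau\circ\alpha_\sigma^\varrho=\alpha_\sigma^\tau$ for $\sigma\leqslant\varrho\leqslant\tau$. Its inductive limit is an object $A$ of $\mathsf A$ with morphisms $\{\alpha_\sigma\colon A_\sigma\to A\}_{\sigma\in\Sigma}$ such that $\alpha_\tau\circ\alpha_\sigma^\tau=\alpha_\sigma$ for $\sigma\leqslant\tau$, and such that for every object $A'$ and morphisms $\{\xi_\sigma\colon A_\sigma\to A'\}_{\sigma\in\Sigma}$ with $\xi_\tau\circ\alpha_\sigma^\tau=\xi_\sigma$ for $\sigma\leqslant\tau$ there is a unique morphism $\nu\colon A\to A'$ with $\nu\circ\alpha_\sigma=\xi_\sigma$ for all $\sigma\in\Sigma$. *)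

(* Defs.v *)
From HB Require Import structures.
From mathcomp Require Import all_boot all_order all_algebra.
From mathcomp Require Import all_classical all_reals all_analysis.

Set Implicit Arguments.
Unset Strict Implicit.
Unset Printing Implicit Defensive.

Import Order.TTheory GRing.Theory Num.Theory.

Local Open Scope classical_set_scope.
Local Open Scope ring_scope.

(* The groups are not assumed abelian: they are multiplicative [groupType]s.
   The topology of a [metricType R] is the one induced by its distance [mdist]. *)
HB.mixin Record isMetricGroup (R : realType) G of Group G & Metric R G := {
  mulg_continuous : continuous (fun p : G * G => (p.1 * p.2)%g) ;
  invg_continuous : continuous (fun x : G => x^-1%g) ;
  mdist_mulgl : forall z x y : G, mdist (z * x)%g (z * y)%g = mdist x y
}.

#[short(type="metricGroupType")]
HB.structure Definition MetricGroup (R : realType) :=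
  { G of Group G & Metric R G & isMetricGroup R G }.

HB.mixin Record MetricGroup_isBiInvariant (R : realType) G of MetricGroup R G := {
  mdist_mulgr : forall z x y : G, mdist (x * z)%g (y * z)%g = mdist x y
}.

#[short(type="biMetricGroupType")]
HB.structure Definition BiMetricGroup (R : realType) :=
  { G of MetricGroup R G & MetricGroup_isBiInvariant R G }.

HB.mixin Record BiMetricGroup_isCompact (R : realType) G of BiMetricGroup R G := {
  metric_group_compact : compact [set: G]
}.

#[short(type="compactBiMetricGroupType")]
HB.structure Definition CompactBiMetricGroup (R : realType) :=
  { G of BiMetricGroup R G & BiMetricGroup_isCompact R G }.

Definition non_expansive (R : realType) (X Y : metricType R) (f : X -> Y) : Prop :=
  forall x y, mdist (f x) (f y) <= mdist x y.

Definition non_expansive_hom (R : realType) (G H : metricGroupType R)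
    (f : G -> H) : Prop :=
  {morph f : x y / (x * y)%g} /\ non_expansive f.

Definition isometrically_isomorphic (R : realType) (G H : metricGroupType R) : Prop :=
  exists f : G -> H,
    [/\ {morph f : x y / (x * y)%g},
        bijective f
      & forall x y, mdist (f x) (f y) = mdist x y].

Definition upward_directed (disp : Order.disp_t) (S : preorderType disp) : Prop :=
  inhabited S /\
  forall s t : S, exists u : S, (s <= u)%O /\ (t <= u)%O.

Section InductiveLimits.
Context (R : realType) (disp : Order.disp_t) (S : preorderType disp).
Variables (G : S -> compactBiMetricGroupType R).
Variables (alpha : forall s t : S, (s <= t)%O -> G s -> G t).

Definition direct_system : Prop :=
  [/\ forall (s t : S) (st : (s <= t)%O), non_expansive_hom (alpha st),
      forall (s : S) (ss : (s <= s)%O), alpha ss =1 id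
    & forall (s r t : S) (sr : (s <= r)%O) (rt : (r <= t)%O) (st : (s <= t)%O),
        alpha rt \o alpha sr =1 alpha st].

Definition surjective_arrows : Prop :=
  forall (s t : S) (st : (s <= t)%O), set_surj [set: G s] [set: G t] (alpha st).

Definition cocone (A : compactBiMetricGroupType R) (a : forall s, G s -> A) : Prop :=
  (forall s, non_expansive_hom (a s)) /\
  forall (s t : S) (st : (s <= t)%O), a t \o alpha st =1 a s.

Definition inductive_limit (A : compactBiMetricGroupType R)
    (a : forall s, G s -> A) : Prop :=
  cocone a /\
  forall (B : compactBiMetricGroupType R) (xi : forall s, G s -> B), cocone xi ->
    exists nu : A -> B,
      [/\ non_expansive_hom nu,
          forall s, nu \o a s =1 xi s
        & forall nu' : A -> B, non_expansive_hom nu' ->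
            (forall s, nu' \o a s =1 xi s) -> nu' =1 nu].

End InductiveLimits.

(* Main.v *)
Require Import Defs.
From HB Require Import structures.
From mathcomp Require Import all_boot all_order all_algebra.
From mathcomp Require Import all_classical all_reals all_analysis.

(** The limit is a quotient of any one member of the system.  Fix [s0].  The
    arrows are surjective, so an element of an arbitrary [G s] agrees, in some
    later [G t], with an element of [G s0]; hence everything that the limit can
    contain is already visible in [G s0].  What is left there of the distances
    is the bi-invariant pseudometric
      rho x y = inf over t >= s0 of the distance in [G t] of the images,
    the infimum of a net which decreases because arrows are non-expansive.
    Dividing [G s0] by the relation [rho x y = 0] gives a compact group with
    bi-invariant metric ([pquot]), and a non-expansive homomorphism out of
    [G s0] which belongs to a cocone is bounded by every distance in the
    infimum, hence factors through it ([limit_arrow_inductive_limit]).  The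
    arrows of this limit are surjective, and this property passes to any other
    inductive limit because the mediating morphism from the constructed limit
    is surjective ([inductive_limit_surj]).

    For the independence of the arrows, let [A] and [B] be the limits for
    [alpha] and [beta].  The arrows [b t : G t -> B] need not be compatible with
    [alpha], but the limit along an ultrafilter finer than the tails of the
    index set,
      xi s x = lim over t of b t (alpha s t x),
    is a cocone for [alpha], and compactness of [G s] keeps each [xi s]
    surjective ([surjective_cocone_of_family]).  The universal property of [A]
    turns it into a surjective non-expansive homomorphism from [A] onto [B], and
    by symmetry there is one from [B] onto [A].  Their composite is a
    non-expansive map of the compact space [A] onto itself, hence an isometry
    ([surj_non_expansive_isometry]); this forces both maps to be isometries. *)

Set Implicit Arguments.
Unset Strict Implicit.
Unset Printing Implicit Defensive.

Import Order.TTheory GRing.Theory Num.Theory.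
Import metricType_numDomainType.

Local Open Scope classical_set_scope.
Local Open Scope ring_scope.
Local Open Scope quotient_scope.

(** * Quotient by a bi-invariant pseudometric *)

Lemma non_expansive_continuous (R : realType) (X Y : metricType R)
    (f : X -> Y) :
  non_expansive f -> continuous f.
Proof.
move=> fne x; apply/cvgrPdist_lt => e e0; apply/nbhs_ballP.
exists e => //= y; rewrite ballEmdist/=; exact: le_lt_trans (fne _ _).
Qed.

Lemma subadditive_op_continuous (R : realType) (X : metricType R)
    (op : X -> X -> X) :
  (forall x x' y y', mdist (op x x') (op y y') <= mdist x y + mdist x' y') ->
  continuous (fun p : X * X => op p.1 p.2).
Proof.
move=> opD [a b]; apply/cvgrPdist_lt => e e0 /=.
have e20 : 0 < e / 2 by rewrite divr_gt0.
exists (ball a (e / 2), ball b (e / 2)); first by split; exact: nbhsx_ballx.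
move=> [a' b'] /= []; rewrite !ballEmdist/= => aa' bb'.
by rewrite (le_lt_trans (opD _ _ _ _))// [ltRHS]splitr ltrD.
Qed.

(** The properties are packed with the distance so that the quotient type
    depends on all of them: its group and metric structures can then be inferred
    from the type alone.  Domination by [mdist] makes the projection continuous,
    which is what transports compactness. *)
Record biinvariant_pseudometric (R : realType) (G : metricGroupType R) :=
  BiinvariantPseudometric {
  pdist :> G -> G -> R ;
  pdistxx : forall x, pdist x x = 0 ;
  pdist_sym : forall x y, pdist x y = pdist y x ;
  pdist_triangle : forall y x z, pdist x z <= pdist x y + pdist y z ;
  pdist_mulgl : forall z x y, pdist (z * x)%g (z * y)%g = pdist x y ;
  pdist_mulgr : forall z x y, pdist (x * z)%g (y * z)%g = pdist x y ;
  pdist_le_mdist : forall x y, pdist x y <= mdist x y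
}.

Section Quotient.
Context (R : realType) (G : compactBiMetricGroupType R).
Variable rho : biinvariant_pseudometric G.
Implicit Types x y z : G.

Lemma pdist_ge0 x y : 0 <= rho x y.
Proof.
have := pdist_triangle rho y x x.
by rewrite pdistxx (pdist_sym rho y x) -mulr2n pmulrn_lge0.
Qed.

(** Joint continuity of the product comes from this bound, and so does its
    compatibility with the relation [rho x y = 0]. *)
Lemma pdistM x x' y y' :
  rho (x * x')%g (y * y')%g <= rho x y + rho x' y'.
Proof.
apply: le_trans (pdist_triangle rho (y * x')%g _ _) _.
by rewrite pdist_mulgr pdist_mulgl.
Qed.

Lemma pdistV x y : rho x^-1%g y^-1%g = rho x y.
Proof.
rewrite -(pdist_mulgl rho x) -(pdist_mulgr rho y).
by rewrite mulgV mul1g -mulgA mulVg mulg1 pdist_sym.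
Qed.

Definition pdist_eq0 x y := `[< rho x y = 0 >].

Lemma pdist_eq0_refl : reflexive pdist_eq0.
Proof. by move=> x; apply/asboolP; exact: pdistxx. Qed.

Lemma pdist_eq0_sym : symmetric pdist_eq0.
Proof. by move=> x y; rewrite /pdist_eq0 pdist_sym. Qed.

Lemma pdist_eq0_trans : transitive pdist_eq0.
Proof.
move=> y x z /asboolP xy /asboolP yz; apply/asboolP/le_anti.
by rewrite pdist_ge0 (le_trans (pdist_triangle rho y x z)) ?xy ?yz ?addr0.
Qed.

Canonical pdist_eq0_equiv :=
  EquivRel pdist_eq0 pdist_eq0_refl pdist_eq0_sym pdist_eq0_trans.

(** The quotient of [G] by the closed normal subgroup of the elements at
    pseudodistance 0 from 1. *)
Definition pquot := {eq_quot pdist_eq0_equiv}.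
HB.instance Definition _ := Choice.on pquot.
HB.instance Definition _ := EqQuotient.on pquot.

Lemma pquotP x y : \pi_pquot x = \pi_pquot y <-> rho x y = 0.
Proof.
split=> [/eqP|xy]; last by apply/eqP; rewrite eqmodE; exact/asboolP.
by rewrite eqmodE => /asboolP.
Qed.

Lemma pdist_repr x : rho (repr (\pi_pquot x)) x = 0.
Proof. by apply/pquotP; rewrite reprK. Qed.

Lemma pquot_ind (P : pquot -> Prop) :
  (forall x, P (\pi_pquot x)) -> forall a, P a.
Proof. by move=> Ppi a; rewrite -(reprK a). Qed.

Definition pquot_one : pquot := \pi_pquot 1%g.
Definition pquot_mul (a b : pquot) : pquot := \pi_pquot (repr a * repr b)%g.
Definition pquot_inv (a : pquot) : pquot := \pi_pquot (repr a)^-1%g.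
Definition pquot_dist (a b : pquot) : R := rho (repr a) (repr b).

Lemma pquot_mulE x y :
  pquot_mul (\pi_pquot x) (\pi_pquot y) = \pi_pquot (x * y)%g.
Proof.
apply/pquotP/le_anti; rewrite pdist_ge0 andbT.
by apply: le_trans (pdistM _ _ _ _) _; rewrite !pdist_repr addr0.
Qed.

Lemma pquot_invE x : pquot_inv (\pi_pquot x) = \pi_pquot x^-1%g.
Proof. by apply/pquotP; rewrite pdistV pdist_repr. Qed.

Lemma pquot_distE x y : pquot_dist (\pi_pquot x) (\pi_pquot y) = rho x y.
Proof.
have le_pi u v u' v' : rho u u' = 0 -> rho v v' = 0 -> rho u v <= rho u' v'.
  move=> uu' vv'; apply: le_trans (pdist_triangle rho u' _ _) _.
  rewrite uu' add0r; apply: le_trans (pdist_triangle rho v' _ _) _.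
  by rewrite (pdist_sym rho v') vv' addr0.
apply: le_anti; rewrite /pquot_dist !le_pi ?pdist_repr//;
  by rewrite pdist_sym pdist_repr.
Qed.

Fact pquot_mulA : associative pquot_mul.
Proof. by do 3!elim/pquot_ind=> ?; rewrite !pquot_mulE mulgA. Qed.

Fact pquot_mul1 : left_id pquot_one pquot_mul.
Proof. by elim/pquot_ind=> ?; rewrite pquot_mulE mul1g. Qed.

Fact pquot_mulr1 : right_id pquot_one pquot_mul.
Proof. by elim/pquot_ind=> ?; rewrite pquot_mulE mulg1. Qed.

Fact pquot_mulV : left_inverse pquot_one pquot_inv pquot_mul.
Proof. by elim/pquot_ind=> ?; rewrite pquot_invE pquot_mulE mulVg. Qed.

Fact pquot_mulrV : right_inverse pquot_one pquot_inv pquot_mul.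
Proof. by elim/pquot_ind=> ?; rewrite pquot_invE pquot_mulE mulgV. Qed.

HB.instance Definition _ := isGroup.Build pquot
  pquot_mulA pquot_mul1 pquot_mulr1 pquot_mulV pquot_mulrV.

Fact pquot_distxx a : pquot_dist a a = 0.
Proof. exact: pdistxx. Qed.

Fact pquot_dist_positivity a b : pquot_dist a b = 0 -> a = b.
Proof.
elim/pquot_ind: a => x; elim/pquot_ind: b => y.
by rewrite pquot_distE => /pquotP.
Qed.

Fact pquot_dist_sym a b : pquot_dist a b = pquot_dist b a.
Proof. exact: pdist_sym. Qed.

Fact pquot_dist_triangle b a c :
  pquot_dist a c <= pquot_dist a b + pquot_dist b c.
Proof. exact: pdist_triangle. Qed.

HB.instance Definition _ := isMetric.Build R pquot
  pquot_distxx pquot_dist_positivity pquot_dist_sym pquot_dist_triangle.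

Lemma pi_pquotM : {morph \pi_pquot : x y / (x * y)%g}.
Proof. by move=> x y; rewrite -pquot_mulE. Qed.

Lemma pi_pquotV : {morph \pi_pquot : x / x^-1%g}.
Proof. by move=> x; rewrite -pquot_invE. Qed.

Lemma mdist_pi x y : mdist (\pi_pquot x) (\pi_pquot y) = rho x y.
Proof. exact: pquot_distE. Qed.

Fact mdist_pquotM (a a' b b' : pquot) :
  mdist (a * a')%g (b * b')%g <= mdist a b + mdist a' b'.
Proof.
elim/pquot_ind: a => x; elim/pquot_ind: a' => x'.
elim/pquot_ind: b => y; elim/pquot_ind: b' => y'.
by rewrite -!pi_pquotM !mdist_pi pdistM.
Qed.

Fact pquot_mulg_continuous :
  continuous (fun p : pquot * pquot => (p.1 * p.2)%g).
Proof. exact: subadditive_op_continuous mdist_pquotM. Qed.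

Fact pquot_invg_continuous : continuous (fun a : pquot => a^-1%g).
Proof.
apply: non_expansive_continuous => a b.
elim/pquot_ind: a => x; elim/pquot_ind: b => y.
by rewrite -!pi_pquotV !mdist_pi pdistV.
Qed.

Fact pquot_mdist_mulgl (c a b : pquot) : mdist (c * a)%g (c * b)%g = mdist a b.
Proof.
elim/pquot_ind: a => x; elim/pquot_ind: b => y; elim/pquot_ind: c => z.
by rewrite -!pi_pquotM !mdist_pi pdist_mulgl.
Qed.

Fact pquot_mdist_mulgr (c a b : pquot) : mdist (a * c)%g (b * c)%g = mdist a b.
Proof.
elim/pquot_ind: a => x; elim/pquot_ind: b => y; elim/pquot_ind: c => z.
by rewrite -!pi_pquotM !mdist_pi pdist_mulgr.
Qed.

HB.instance Definition _ := isMetricGroup.Build R pquot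
  pquot_mulg_continuous pquot_invg_continuous pquot_mdist_mulgl.

HB.instance Definition _ :=
  MetricGroup_isBiInvariant.Build R pquot pquot_mdist_mulgr.

Fact pquot_compact : compact [set: pquot].
Proof.
suff -> : [set: pquot] = \pi_pquot @` [set: G].
  apply: continuous_compact; last exact: metric_group_compact.
  apply/continuous_subspaceT/non_expansive_continuous => x y.
  by rewrite mdist_pi pdist_le_mdist.
by apply/seteqP; split=> // a _; exists (repr a); rewrite ?reprK.
Qed.

HB.instance Definition _ := BiMetricGroup_isCompact.Build R pquot pquot_compact.

End Quotient.

(** * Compactness: ultralimits and surjective non-expansive maps *)

Section Compact.
Context (R : realType).

Lemma ultra_fmap_cvg (I : Type) (U : set_system I) (T : topologicalType)
    (f : I -> T) :
  UltraFilter U -> compact [set: T] -> exists l : T, f @ U --> l.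
Proof.
move=> UU cT; have [l [_ ll]] := cT (f @ U) _ filterT.
exists l => V lV; have [//|UnV] := in_ultra_setVsetC (f @^-1` V) UU.
by have [x []] := ll (~` V) V UnV lV.
Qed.

Lemma cvg_mdist_le (I : Type) (F : set_system I) {FF : ProperFilter F}
    (T : metricType R) (f g : I -> T) (l m : T) (c : R) :
  f @ F --> l -> g @ F --> m ->
  (\forall i \near F, mdist (f i) (g i) <= c) -> mdist l m <= c.
Proof.
move=> fl gm fg; apply/ler_addgt0Pr => e e0.
have e20 : 0 < e / 2 by rewrite divr_gt0.
have [i [[fgi li] mi]] := filter_ex (filterI (filterI fg
  (cvgr_dist_lt fl e20)) (cvgr_dist_lt gm e20)).
apply: le_trans (metric_triangle _ (f i) _) _.
rewrite [in leRHS](splitr e) addrCA lerD ?(ltW li)//.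
apply: le_trans (metric_triangle _ (g i) _) _.
by rewrite lerD// metric_sym ltW.
Qed.

(** Follow [x] and [y] backwards along preimages of [h]: distances do not
    decrease.  By compactness the pair of backward orbits nearly returns to
    itself at two times m < n, and applying [h] m times, which does not increase
    distances, makes it nearly return to its starting point [(h x, h y)].  Hence
    some pair of preimages, at least as far apart as [x] and [y], is almost as
    close as [h x] and [h y]. *)
Lemma surj_non_expansive_isometry (T : metricType R) (h : T -> T) :
  compact [set: T] -> set_surj [set: T] [set: T] h -> non_expansive h ->
  forall x y, mdist (h x) (h y) = mdist x y.
Proof.
move=> cT hs hne x y; apply: le_anti; rewrite hne/=.
have /choice[k hk] : forall z, exists w, h w = z.
  by move=> z; have [w _ hw] := hs z I; exists w.
have hn z w n : mdist (iter n h z) (iter n h w) <= mdist z w.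
  by elim: n => //= n; apply: le_trans; exact: hne.
have kn z w n : mdist z w <= mdist (iter n k z) (iter n k w).
  elim: n => //= n IHn; apply: le_trans IHn _.
  by rewrite -{1}(hk (iter n k z)) -{1}(hk (iter n k w)).
(* The orbit of [h z] must pass through [z] itself, which [k (h z)] need not
   be; only from [z] on are preimages chosen by [k]. *)
pose orb z n := if n is m.+1 then iter m k z else h z.
have horb n m z : (n <= m)%N -> iter n h (orb z m) = orb z (m - n)%N.
  elim: n m => [|n IHn] [|m]// nm; rewrite ?subn0// subSS -IHn//.
  by rewrite iterSr; case: m {nm} => //= m; rewrite hk.
apply/ler_addgt0Pr => e e0.
have e40 : 0 < e / 2 / 2 by rewrite !divr_gt0.
have [q [_ qq]] :
    [set: T * T] `&` cluster ((fun n => (orb x n, orb y n)) @ \oo) !=set0.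
  by rewrite -setXTT; apply: (compact_setX cT cT); exact: filterE.
have near_q N : exists n, [/\ (N <= n)%N,
    mdist q.1 (orb x n) < e / 2 / 2 & mdist q.2 (orb y n) < e / 2 / 2].
  have [] := qq ((fun n => (orb x n, orb y n)) @` [set n | (N <= n)%N])
      (ball q.1 (e / 2 / 2) `*` ball q.2 (e / 2 / 2)).
  - by apply: filterS (nbhs_infty_ge N) => n Nn; exists n.
  - by exists (ball q.1 (e / 2 / 2), ball q.2 (e / 2 / 2)) => //;
      split; exact: nbhsx_ballx.
  - move=> _ [[n Nn <-]] []; rewrite !ballEmdist/= => xn yn.
    by exists n.
have [m [_ xm ym]] := near_q 0%N; have [n [mn xn yn]] := near_q m.+1.
have close z r : mdist r (orb z m) < e / 2 / 2 ->
    mdist r (orb z n) < e / 2 / 2 ->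
    mdist (h z) (iter (n - m).-1 k z) <= e / 2.
  move=> rm rn.
  have -> : h z = iter m h (orb z m) by rewrite horb// subnn.
  have -> : iter (n - m).-1 k z = iter m h (orb z n).
    by rewrite horb 1?ltnW//; move: mn; rewrite -subn_gt0; case: (n - m)%N.
  apply: le_trans (hn _ _ _) _; apply: le_trans (metric_triangle _ r _) _.
  by rewrite metric_sym [leRHS]splitr lerD// ltW.
apply: le_trans (kn _ _ (n - m).-1) _.
apply: le_trans (metric_triangle _ (h x) _) _.
rewrite [in leRHS](splitr e) [leRHS]addrCA lerD//.
  by rewrite metric_sym (close _ q.1).
by apply: le_trans (metric_triangle _ (h y) _) _; rewrite lerD// (close _ q.2).
Qed.

End Compact.

(** * The inductive limit of a direct system with surjective arrows *)

Section DirectSystem.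
Context (R : realType) (disp : Order.disp_t) (S : preorderType disp).
Variables (G : S -> compactBiMetricGroupType R).
Variables (alpha : forall s t : S, (s <= t)%O -> G s -> G t).
Hypothesis dirS : upward_directed S.
Hypothesis sysA : direct_system alpha.
Hypothesis surjA : surjective_arrows alpha.

Lemma arrowM s t (st : (s <= t)%O) : {morph alpha st : x y / (x * y)%g}.
Proof. by have [+ _ _] := sysA => /(_ s t st)[]. Qed.

Lemma arrow_le s t (st : (s <= t)%O) x y :
  mdist (alpha st x) (alpha st y) <= mdist x y.
Proof. by have [+ _ _] := sysA => /(_ s t st)[_]; apply. Qed.

Lemma arrow_id s (ss : (s <= s)%O) x : alpha ss x = x.
Proof. by have [_ + _] := sysA; apply. Qed.

Lemma arrow_comp s r t (sr : (s <= r)%O) (rt : (r <= t)%O) (st : (s <= t)%O) x :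
  alpha rt (alpha sr x) = alpha st x.
Proof. by have [_ _ +] := sysA => /(_ s r t sr rt st x). Qed.

Lemma arrow_surj s t (st : (s <= t)%O) y : exists x, alpha st x = y.
Proof. by have [x _ <-] := @surjA s t st y I; exists x. Qed.

Section Limit.
Variable s0 : S.

Definition limit_dist (x y : G s0) : R :=
  inf [set r | exists t (st : (s0 <= t)%O),
                 r = mdist (alpha st x) (alpha st y)].

Lemma limit_dist_le x y t (st : (s0 <= t)%O) :
  limit_dist x y <= mdist (alpha st x) (alpha st y).
Proof.
apply: ge_inf; last by exists t, st.
by exists 0 => _ [u [su ->]]; exact: mdist_ge0.
Qed.

Lemma le_limit_dist x y c :
  (forall t (st : (s0 <= t)%O), c <= mdist (alpha st x) (alpha st y)) ->
  c <= limit_dist x y.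
Proof.
move=> cle; apply: lb_le_inf; last by move=> _ [t [st ->]].
by exists (mdist (alpha (lexx s0) x) (alpha (lexx s0) y)), s0, (lexx s0).
Qed.

Fact limit_distxx x : limit_dist x x = 0.
Proof.
apply: le_anti; rewrite -{1}(mdistxx (alpha (lexx s0) x)) limit_dist_le/=.
by apply: le_limit_dist => t st; exact: mdist_ge0.
Qed.

Fact limit_dist_sym x y : limit_dist x y = limit_dist y x.
Proof.
by congr inf; apply/seteqP; split=> _ [t [st ->]]; exists t, st;
  rewrite metric_sym.
Qed.

(** Indices nearly realizing the two terms on the right may differ; at a common
    later one both distances have decreased, and there the triangle inequality
    applies. *)
Fact limit_dist_triangle y x z :
  limit_dist x z <= limit_dist x y + limit_dist y z.
Proof.
rewrite -lerBlDr; apply: le_limit_dist => t st.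
rewrite lerBlDr -lerBlDl; apply: le_limit_dist => t' st'.
rewrite lerBlDl; have [u [tu t'u]] := dirS.2 t t'.
have su := le_trans st tu.
apply: le_trans (limit_dist_le x z su) _.
apply: le_trans (metric_triangle _ (alpha su y) _) _; rewrite lerD//.
  by rewrite -!(arrow_comp st tu su) arrow_le.
by rewrite -!(arrow_comp st' t'u su) arrow_le.
Qed.

Fact limit_dist_mulgl z x y : limit_dist (z * x)%g (z * y)%g = limit_dist x y.
Proof.
congr inf; apply/seteqP; split=> _ [t [st ->]]; exists t, st;
  by rewrite !arrowM mdist_mulgl.
Qed.

Fact limit_dist_mulgr z x y : limit_dist (x * z)%g (y * z)%g = limit_dist x y.
Proof.
congr inf; apply/seteqP; split=> _ [t [st ->]]; exists t, st;
  by rewrite !arrowM mdist_mulgr.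
Qed.

Fact limit_dist_le_mdist x y : limit_dist x y <= mdist x y.
Proof. by have := limit_dist_le x y (lexx s0); rewrite !arrow_id. Qed.

Definition limit_pseudometric : biinvariant_pseudometric (G s0) :=
  BiinvariantPseudometric limit_distxx limit_dist_sym limit_dist_triangle
    limit_dist_mulgl limit_dist_mulgr limit_dist_le_mdist.

Let A : compactBiMetricGroupType R := pquot limit_pseudometric.

(** The arrow of the limit sends [x] to the class of any [y] that it merges
    with. *)
Definition merge s (x : G s) (y : G s0) : Prop :=
  exists t (st : (s <= t)%O) (s0t : (s0 <= t)%O), alpha st x = alpha s0t y.

(** Independence of the choice of [y] (take [x = x']) and non-expansiveness of
    the limit arrows both come from this single estimate at a common index. *)
Lemma merge_limit_dist s (x x' : G s) y y' :
  merge x y -> merge x' y' -> limit_dist y y' <= mdist x x'.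
Proof.
move=> [t [st [s0t xy]]] [t' [st' [s0t' xy']]].
have [u [tu t'u]] := dirS.2 t t'.
have su := le_trans st tu; have s0u := le_trans s0t tu.
apply: le_trans (limit_dist_le y y' s0u) _.
rewrite -(arrow_comp s0t tu s0u) -(arrow_comp s0t' t'u s0u) -xy -xy'.
by rewrite (arrow_comp st tu su) (arrow_comp st' t'u su) arrow_le.
Qed.

Lemma merge_pi s (x : G s) y y' :
  merge x y -> merge x y' -> \pi_A y = \pi_A y'.
Proof.
move=> xy xy'; apply/pquotP/le_anti.
rewrite (pdist_ge0 limit_pseudometric) andbT.
by rewrite -(mdistxx x); exact: merge_limit_dist.
Qed.

Lemma mergeM s (x x' : G s) y y' :
  merge x y -> merge x' y' -> merge (x * x')%g (y * y')%g.
Proof.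
move=> [t [st [s0t xy]]] [t' [st' [s0t' xy']]].
have [u [tu t'u]] := dirS.2 t t'.
have su := le_trans st tu; have s0u := le_trans s0t tu.
exists u, su, s0u; rewrite !arrowM; congr (_ * _)%g.
  by rewrite -(arrow_comp st tu su) -(arrow_comp s0t tu s0u) xy.
by rewrite -(arrow_comp st' t'u su) -(arrow_comp s0t' t'u s0u) xy'.
Qed.

Lemma merge_arrow s r (sr : (s <= r)%O) (x : G s) y :
  merge x y -> merge (alpha sr x) y.
Proof.
move=> [t [st [s0t xy]]]; have [u [tu ru]] := dirS.2 t r.
exists u, ru, (le_trans s0t tu).
rewrite (arrow_comp sr ru (le_trans st tu)) -(arrow_comp st tu) xy.
exact: arrow_comp.
Qed.

Lemma merge_exr s (x : G s) : exists y, merge x y.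
Proof.
have [t [st s0t]] := dirS.2 s s0.
have [y yx] := arrow_surj s0t (alpha st x).
by exists y, t, st, s0t.
Qed.

Lemma merge_exl s (y : G s0) : exists x : G s, merge x y.
Proof.
have [t [st s0t]] := dirS.2 s s0.
have [x xy] := arrow_surj st (alpha s0t y).
by exists x, t, st, s0t.
Qed.

Lemma merge_refl (y : G s0) : merge y y.
Proof. by exists s0, (lexx s0), (lexx s0). Qed.

Definition limit_arrow s (x : G s) : A := \pi_A (projT1 (cid (merge_exr x))).

Lemma limit_arrowE s (x : G s) y : merge x y -> limit_arrow x = \pi_A y.
Proof. exact: merge_pi (projT2 (cid (merge_exr x))). Qed.

Lemma limit_arrow_surj s : set_surj [set: G s] [set: A] (@limit_arrow s).
Proof.
elim/pquot_ind=> y _; have [x xy] := merge_exl s y.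
by exists x => //; exact: limit_arrowE.
Qed.

Lemma limit_arrow_cocone : cocone alpha limit_arrow.
Proof.
split=> [s|s t st x]; last first.
  have [y xy] := merge_exr x.
  by rewrite /= (limit_arrowE xy); exact/limit_arrowE/merge_arrow.
split=> x x'; have [y xy] := merge_exr x; have [y' xy'] := merge_exr x'.
  by rewrite (limit_arrowE (mergeM xy xy')) (limit_arrowE xy) (limit_arrowE xy')
    pi_pquotM.
by rewrite (limit_arrowE xy) (limit_arrowE xy') mdist_pi merge_limit_dist.
Qed.

Lemma limit_arrow_inductive_limit : inductive_limit alpha limit_arrow.
Proof.
split=> [|B xi [xih xic]]; first exact: limit_arrow_cocone.
have xi_le y y' : mdist (xi s0 y) (xi s0 y') <= limit_dist y y'.
  by apply: le_limit_dist => t st; rewrite -!(xic _ _ st) (xih t).2.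
pose nu (a : A) : B := xi s0 (repr a).
have nuE y : nu (\pi_A y) = xi s0 y.
  apply/mdist_positivity/le_anti; rewrite mdist_ge0 andbT.
  rewrite -[leRHS](pdist_repr limit_pseudometric y); exact: xi_le.
exists nu; split.
- split; last by move=> a b; exact: xi_le.
  elim/pquot_ind=> x; elim/pquot_ind=> y.
  by rewrite -pi_pquotM !nuE (xih s0).1.
- move=> s x; have [y xy] := merge_exr x.
  rewrite /= (limit_arrowE xy) nuE; case: xy => t [st [s0t xy]].
  by rewrite -(xic _ _ st) -(xic _ _ s0t) /= xy.
- move=> nu' _ nu'E; elim/pquot_ind=> y.
  by rewrite nuE -(nu'E s0) /= (limit_arrowE (merge_refl y)).
Qed.

End Limit.

Lemma inductive_limit_ex :
  exists (A : compactBiMetricGroupType R) (a : forall s, G s -> A),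
    inductive_limit alpha a /\ forall s, set_surj [set: G s] [set: A] (a s).
Proof.
have [s0] := dirS.1; exists (pquot (limit_pseudometric s0)).
exists (@limit_arrow s0).
by split; [exact: limit_arrow_inductive_limit|exact: limit_arrow_surj].
Qed.

(** With [nu : A -> C] and [mu : C -> A] the mediating morphisms to and from the
    constructed limit [C], uniqueness gives that [mu \o nu] is the identity; so
    [mu] is onto, and [a s = mu \o c s] is a composite of surjections. *)
Lemma inductive_limit_surj (A : compactBiMetricGroupType R)
    (a : forall s, G s -> A) :
  inductive_limit alpha a -> forall s, set_surj [set: G s] [set: A] (a s).
Proof.
move=> [coa univa] s.
have [C [c [[coc univc] surjc]]] := inductive_limit_ex.
have [nu [nuh nuE _]] := univa C c coc.
have [mu [muh muE _]] := univc A a coa.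
have [id' [_ _ uniq]] := univa A a coa.
have munu z : mu (nu z) = z.
  transitivity (id' z); last by rewrite -(uniq id)//; split.
  apply: (uniq (mu \o nu)) => [|t x].
    split=> x y /=; first by rewrite nuh.1 muh.1.
    exact: le_trans (muh.2 _ _) (nuh.2 _ _).
  by rewrite -[RHS](muE t x) /= -(nuE t x).
move=> z _; have [x _ xz] := surjc s (nu z) I.
by exists x => //; rewrite -(muE s x) /= xz.
Qed.

(** * Independence of the choice of the arrows *)

(** The ultralimit over [t] of [b t (alpha s t x)] is compatible with [alpha]
    since the terms for [x] and for its image in [G r] coincide once [t >= r],
    and the ultrafilter does not see the other indices. *)
Lemma surjective_cocone_of_family (B : compactBiMetricGroupType R)
    (b : forall s, G s -> B) :
  (forall s, non_expansive_hom (b s)) ->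
  (forall s, set_surj [set: G s] [set: B] (b s)) ->
  exists xi : forall s, G s -> B,
    cocone alpha xi /\ forall s, set_surj [set: G s] [set: B] (xi s).
Proof.
move=> bh bs; have cB := @metric_group_compact R B.
pose tails := filter_from [set: S] (fun s => [set t | (s <= t)%O]).
have tailsP : ProperFilter tails.
  apply: filter_from_proper; last by move=> s _; exists s => /=.
  apply: filter_from_filter; first by have [s] := dirS.1; exists s.
  move=> s t _ _; have [u [su tu]] := dirS.2 s t; exists u => // v /= uv.
  by split; exact: le_trans uv.
have [U [UU tailsU]] := ultraFilterLemma tailsP.
have near_ge s : \forall t \near U, (s <= t)%O by apply: tailsU; exists s.
have /choice[L LE] (f : S -> B) : exists l : B, f @ U --> l.
  exact: ultra_fmap_cvg.
(* The limit is taken of a function of all indices [t], hence the default 1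
   where [s <= t] fails, which is outside a set of the ultrafilter. *)
pose push s t (x : G s) : G t :=
  if pselect (s <= t)%O is left st then alpha st x else 1%g.
have pushE s t (st : (s <= t)%O) x : push s t x = alpha st x.
  by rewrite /push; case: pselect => // st'; rewrite (bool_irrelevance st st').
pose xi s x := L (fun t => b t (push s t x)).
have xi_lim s x : (fun t => b t (push s t x)) @ U --> xi s x by exact: LE.
exists xi; split=> [|s y _].
- split=> [s|s r sr x /=].
  + split=> [x y|x y].
    * apply/mdist_positivity/le_anti; rewrite mdist_ge0 andbT.
      have lim_mul := continuous2_cvg _ (h := fun u v : B => (u * v)%g)
        (@mulg_continuous R B (xi s x, xi s y)) (xi_lim s x) (xi_lim s y).
      apply: (cvg_mdist_le (xi_lim s _) (lim_mul _)).
      apply: filterS (near_ge s) => t st.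
      by rewrite !(pushE _ _ st) arrowM (bh t).1 mdistxx.
    * apply: (cvg_mdist_le (xi_lim s x) (xi_lim s y)).
      apply: filterS (near_ge s) => t st; rewrite !(pushE _ _ st).
      exact: le_trans ((bh t).2 _ _) (arrow_le _ _ _).
  + apply/mdist_positivity/le_anti; rewrite mdist_ge0 andbT.
    apply: (cvg_mdist_le (xi_lim r _) (xi_lim s x)).
    apply: filterS (near_ge r) => t rt; have st := le_trans sr rt.
    by rewrite (pushE _ _ rt) (pushE _ _ st) (arrow_comp sr rt st) mdistxx.
(* The preimage of [y] is the ultralimit in [G s] of points [w t] which are
   sent to [y] at stage [t]. *)
- have /choice[w wE] (t : S) :
      exists w, forall st : (s <= t)%O, b t (alpha st w) = y.
    have [st|nst] := pselect (s <= t)%O; last by exists 1%g => st; case: nst.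
    have [z _ zy] := bs t y I; have [w wz] := arrow_surj st z.
    by exists w => st'; rewrite (bool_irrelevance st' st) wz.
  have [x wx] := ultra_fmap_cvg w UU (@metric_group_compact R (G s)).
  exists x => //; apply/mdist_positivity/le_anti; rewrite mdist_ge0 andbT.
  apply/ler_addgt0Pr => e e0; rewrite add0r.
  apply: (cvg_mdist_le (xi_lim s x) (cvg_cst y)).
  apply: filterS2 (near_ge s) (cvgr_dist_le wx e0) => t st /(le_trans _); apply.
  rewrite (pushE _ _ st) -(wE t st).
  exact: le_trans ((bh t).2 _ _) (arrow_le _ _ _).
Qed.

End DirectSystem.

Lemma inductive_limit_onto (R : realType) (disp : Order.disp_t)
    (S : preorderType disp) (G : S -> compactBiMetricGroupType R)
    (alpha beta : forall s t : S, (s <= t)%O -> G s -> G t)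
    (A B : compactBiMetricGroupType R)
    (a : forall s, G s -> A) (b : forall s, G s -> B) :
  upward_directed S ->
  direct_system alpha -> surjective_arrows alpha ->
  direct_system beta -> surjective_arrows beta ->
  inductive_limit alpha a -> inductive_limit beta b ->
  exists f : A -> B, non_expansive_hom f /\ set_surj [set: A] [set: B] f.
Proof.
move=> dirS sysA surjA sysB surjB [_ univa] limb.
have [xi [coxi surjxi]] := surjective_cocone_of_family dirS sysA surjA
  limb.1.1 (inductive_limit_surj dirS sysB surjB limb).
have [f [fh fE _]] := univa B xi coxi.
exists f; split=> // y _; have [s] := dirS.1.
by have [x _ <-] := surjxi s y I; exists (a s x); rewrite -?fE.
Qed.

(** The distance of [f x] and [f y] lies between that of [x] and [y] and that of
    their images under [g \o f], which is an isometry of [A]. *)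
Lemma mutually_onto_isometric (R : realType) (A B : compactBiMetricGroupType R)
    (f : A -> B) (g : B -> A) :
  non_expansive_hom f -> set_surj [set: A] [set: B] f ->
  non_expansive g -> set_surj [set: B] [set: A] g ->
  isometrically_isomorphic A B.
Proof.
move=> [fM fne] fs gne gs.
have gf_iso : forall x y, mdist (g (f x)) (g (f y)) = mdist x y.
  apply: (@surj_non_expansive_isometry _ _ (g \o f)).
  - exact: metric_group_compact.
  - move=> z _; have [y _ <-] := gs z I; have [x _ <-] := fs y I.
    by exists x.
  - by move=> x y; exact: le_trans (gne _ _) (fne _ _).
have f_iso x y : mdist (f x) (f y) = mdist x y.
  by apply: le_anti; rewrite fne -{1}gf_iso gne.
have /choice[h hf] y : exists x, f x = y by have [x _ <-] := fs y I; exists x.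
exists f; split=> //; exists h => // x.
by apply: mdist_positivity; rewrite -f_iso hf mdistxx.
Qed.

Theorem theorem3p1 (R : realType) (disp : Order.disp_t) (S : preorderType disp)
    (G : S -> compactBiMetricGroupType R)
    (alpha : forall s t : S, (s <= t)%O -> G s -> G t) :
  upward_directed S ->
  direct_system alpha ->
  surjective_arrows alpha ->
  [/\ exists (A : compactBiMetricGroupType R) (a : forall s, G s -> A),
        inductive_limit alpha a,
      forall beta : forall s t : S, (s <= t)%O -> G s -> G t,
        direct_system beta ->
        surjective_arrows beta ->
        forall (A : compactBiMetricGroupType R) (a : forall s, G s -> A)
               (B : compactBiMetricGroupType R) (b : forall s, G s -> B),
          inductive_limit alpha a ->
          inductive_limit beta b ->
          isometrically_isomorphic A B
    & forall (A : compactBiMetricGroupType R) (a : forall s, G s -> A),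
        inductive_limit alpha a ->
        forall s : S, set_surj [set: G s] [set: A] (a s)].
Proof.
move=> dirS sysA surjA; split.
- by have [A [a [lima _]]] := inductive_limit_ex dirS sysA surjA; exists A, a.
- move=> beta sysB surjB A a B b lima limb.
  have [f [fh fs]] := inductive_limit_onto dirS sysA surjA sysB surjB lima limb.
  have [g [gh gs]] := inductive_limit_onto dirS sysB surjB sysA surjA limb lima.
  exact: mutually_onto_isometric fh fs gh.2 gs.
- by move=> A a; exact: inductive_limit_surj.
Qed.
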